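(* For each $c\in\{1,2,3\}$, the assignment $$E(z)\mapsto 0,\qquad K^\pm(z)\mapsto K^\pm(z),\qquad C\mapsto s_c^{-1}$$ from $\mathcal K$ to the Heisenberg algebra $\mathcal H_c^{\mathsf{CD}}$ endows the Fock module $\mathcal F^{\mathsf{CD}}_c$ of $\mathcal H_c^{\mathsf{CD}}$ with a structure of a $\mathcal K$-module of level $s_c^{-1}$ (i.e. on which $C$ acts by $s_c^{-1}$).
   Context: Parameters: $q_1,q_2,q_3\in\mathbb C^\times$, $q_1q_2q_3=1$, with fixed logarithms, $q_i^a=\exp(a\ln q_i)$, generic ($q_1^aq_2^b=1$ for integers $a,b$ only if $a=b=0$). $s_c=q_c^{1/2}$. $g(z,w)=\prod_{i=1}^3(z-q_iw)$, $\bar g(z,w)=\prod_{i=1}^3(z-q_i^{-1}w)$, $\kappa_r=\prod_{i=1}^3(1-q_i^r)$, $\delta(z)=\sum_{n\in\mathbb Z}z^n$. $\mathrm{Sym}_{z_1,\dots,z_N}F=\frac1{N!}\sum_{\pi\in\mathfrak S_N}F(z_{\pi(1)},\dots,z_{\pi(N)})$. Algebra $\mathcal K$: generated by coefficients of $E(z)=\sum_nE_nz^{-n}$, $K^\pm(z)=\exp(\sum_{\pm r>0}H_rz^{-r})$ and an invertible central element $C$; $K(z)=K^-(z)K^+(C^2z)$. Relations: $g(z,w)E(z)E(w)+g(w,z)E(w)E(z)=\frac1{\kappa_1}\bigl(g(z,w)\delta(C^2\tfrac zw)K(z)+g(w,z)\delta(C^2\tfrac wz)K(w)\bigr)$; $K^\pm(z)K^\pm(w)=K^\pm(w)K^\pm(z)$;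 $g(z,w)g(z,C^2w)K^+(z)K^-(w)=\bar g(z,w)\bar g(z,C^2w)K^-(w)K^+(z)$; $g(z,w)K^\pm(z)E(w)=\bar g(z,w)E(w)K^\pm(z)$; $\mathrm{Sym}_{z_1,z_2,z_3}\frac{z_2}{z_3}[E(z_1),[E(z_2),E(z_3)]]=\mathrm{Sym}_{z_1,z_2,z_3}X(z_1,z_2,z_3)\kappa_1^{-1}\delta(C^2z_1/z_3)K^-(z_1)E(z_2)K^+(z_3)$, where $X=\frac{(z_1+z_2)(z_3^2-z_1z_2)}{z_1z_2z_3}G(z_2/z_3)+\frac{(z_2+z_3)(z_1^2-z_2z_3)}{z_1z_2z_3}G(z_1/z_2)+\frac{(z_3+z_1)(z_2^2-z_3z_1)}{z_1z_2z_3}$ and $G(w/z)$ is the power series expansion of $\bar g(z,w)/g(z,w)$ in $w/z$. (Coefficients of $K(z)$ are infinite sums which are well defined on graded modules with degrees bounded above, where $\deg E_n=n$, $\deg H_r=r$.) For $k\in\mathbb C^\times$, $\mathcal H_k$ is the Heisenberg algebra generated by $H_r$, $r\ne0$, with $[H_r,H_s]=-\delta_{r+s,0}\,\kappa_r\frac{1+k^{2r}}{r}$ for $r>0$ (and $[H_r,H_s]=0$ for $r,s$ of the same sign). $\mathcal H_c^{\mathsf{CD}}=\mathcal H_{s_c^{-1}}$, and $\mathcal F_c^{\mathsf{CD}}$ is its Fock module (generated by a vacuum vector annihilated by all $H_r$, $r>0$, free over $\mathbb C[H_r]_{r<0}$). *)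

(* Defs.v *)
From HB Require Import structures.
From mathcomp Require Import all_boot all_order all_algebra.
From mathcomp Require Import perm.
From mathcomp Require Export complex.
From mathcomp Require Import boolp classical_sets functions cardinality fsbigop.
From mathcomp Require Import reals topology normedtype sequences exp trigo.

Set Implicit Arguments.
Unset Strict Implicit.
Unset Printing Implicit Defensive.

Import Order.TTheory GRing.Theory Num.Theory.

Local Open Scope classical_set_scope.
Local Open Scope ring_scope.

Definition cexp (R : realType) (x : R[i]) : R[i] :=
  ((expR (complex.Re x) * cos (complex.Im x))
    +i* (expR (complex.Re x) * sin (complex.Im x)))%C.

(* Indices 0, 1, 2 : 'I_3 stand for the 1, 2, 3 of the text. *)
Definition generic_q (F : fieldType) (q : 'I_3 -> F) : Prop :=
  forall a b : int, q 0 ^ a * q 1 ^ b = 1 -> a = 0 /\ b = 0.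

Definition kappa (F : fieldType) (q : 'I_3 -> F) (r : int) : F :=
  \prod_(i < 3) (1 - q i ^ r).

(* Formal distributions in n variables with coefficients operators on V:       *)
(* (f a) is the coefficient of \prod_i z_i ^ (a i).                             *)
Definition expo (n : nat) := {ffun 'I_n -> int}.
Definition fdist (n : nat) (V : Type) := expo n -> V -> V.

Section FormalDistributions.
Context (F : fieldType) (V : lmodType F) (n : nat).
Implicit Types (f g : fdist n V) (i j : 'I_n) (D : V -> V).

Definition unit_expo i : expo n := [ffun j => (j == i)%:R].

(* The sum giving a coefficient of a product is a finite-support sum: it is     *)
(* taken after application to a vector v, and all the products written below    *)
(* involve only finitely many nonzero terms for each v as soon as the degrees   *)
(* of V are bounded above.                                                      *)
Definition fmul f g : fdist n V :=
  fun a v => \sum_(b \in [set: expo n]) f b (g (a - b) v).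

Definition fconst D : fdist n V := fun a => if a == 0 then D else 0.

Definition fone : fdist n V := fconst id.

(* The series \sum_k f_k z_i ^ k. *)
Definition in_var i (f_ : int -> V -> V) : fdist n V :=
  fun a => if a == unit_expo i *~ a i then f_ (a i) else 0.

(* The series \sum_k f_k (z_i / z_j) ^ k, for i != j. *)
Definition in_ratio i j (f_ : int -> V -> V) : fdist n V :=
  fun a => if a == (unit_expo i - unit_expo j) *~ a i then f_ (a i) else 0.

Definition var i : fdist n V :=
  in_var i (fun k => if k == 1 then id else 0).

Definition var_inv i : fdist n V :=
  in_var i (fun k => if k == -1 then id else 0).

Definition fbracket f g : fdist n V := fmul f g - fmul g f.

Definition fSym f : fdist n V :=
  (n`!%:R : F)^-1 *: \sum_(s : 'S_n) (fun a : expo n => f [ffun i => a (s i)]).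

End FormalDistributions.

Arguments fone {F V n}.
Arguments var {F V n} i.
Arguments var_inv {F V n} i.

Declare Scope fdist_scope.
Delimit Scope fdist_scope with FD.
Infix "**" := fmul (at level 41, right associativity) : fdist_scope.
Local Open Scope fdist_scope.

Section Exponential.
Context (F : fieldType) (V : lmodType F).

(* pow_coef A k m is the coefficient of x ^ m in (\sum_(r > 0) A_r x ^ r) ^ k.  *)
Fixpoint pow_coef (A : nat -> V -> V) (k m : nat) : V -> V :=
  if k is k'.+1 then \sum_(r < m) (A r.+1 \o pow_coef A k' (m - r.+1)%N)
  else if m == 0%N then id else 0.

(* The coefficient of x ^ m in exp (\sum_(r > 0) A_r x ^ r). *)
Definition exp_coef (A : nat -> V -> V) (m : nat) : V -> V :=
  \sum_(k < m.+1) (k`!%:R : F)^-1 *: pow_coef A k m.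

End Exponential.

(* The operators by which the generators act. C^-1 is part of the algebra, so   *)
(* its action is part of the data. H_0 does not exist in the algebra: the value *)
(* opH 0 is never used.                                                         *)
Record Koperators (F : fieldType) (V : lmodType F) := MkKoperators {
  opE : int -> {linear V -> V};
  opH : int -> {linear V -> V};
  opC : {linear V -> V};
  opCinv : {linear V -> V} }.

(* A direct sum decomposition of V indexed by degrees in int, given by its      *)
(* projections, with degrees bounded above.                                     *)
Record bounded_grading (F : fieldType) (V : lmodType F)
    (pr : int -> {linear V -> V}) : Prop := MkGrading {
  grading_finite : forall v, finite_set [set d | pr d v != 0];
  grading_sum : forall v, v = \sum_(d \in [set: int]) pr d v;
  grading_orth : forall (d e : int) v, pr d (pr e v) = if d == e then pr e v else 0;
  grading_bounded : exists N : int, forall (d : int) v, N < d -> pr d v = 0 }.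

Definition has_degree (F : fieldType) (V : lmodType F)
    (pr : int -> {linear V -> V}) (A : V -> V) (m : int) : Prop :=
  forall (d : int) v, pr d v = v -> pr (d + m) (A v) = A v.

Section Relations.
Context (F : fieldType) (q : 'I_3 -> F) (V : lmodType F) (X : Koperators V).

Definition Cpow (m : int) : V -> V :=
  match m with
  | Posz k => iter k (opC X)
  | Negz k => iter k.+1 (opCinv X)
  end.

Definition Kplus_coef (m : nat) : V -> V :=
  exp_coef (fun r => opH X r%:Z) m.
Definition Kminus_coef (m : nat) : V -> V :=
  exp_coef (fun r => opH X (- r%:Z)) m.

(* g(z,w) and \bar g(z,w). *)
Definition gfun (n : nat) (Z W : fdist n V) : fdist n V :=
  \big[@fmul F V n/fone]_(i < 3) (Z - q i *: W).
Definition gbar (n : nat) (Z W : fdist n V) : fdist n V :=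
  \big[@fmul F V n/fone]_(i < 3) (Z - (q i)^-1 *: W).

(* The coefficient of x ^ m in \prod_i (1 - q_i^-1 x) / (1 - q_i x), where      *)
(* x = w / z; the geometric series are truncated after x ^ m.                   *)
Definition Gcoef (m : nat) : F :=
  (\prod_(i < 3) (1 - (q i)^-1 *: 'X)
    * \prod_(i < 3) \poly_(j < m.+1) (q i ^+ j))`_m.

Section Variables.
Context (n : nat).
Implicit Types i j : 'I_n.

Definition Ecur i : fdist n V := in_var i (fun k => opE X (- k)).

Definition Kplus i : fdist n V :=
  in_var i (fun k => if k <= 0 then Kplus_coef `|k|%N else 0).
Definition Kminus i : fdist n V :=
  in_var i (fun k => if 0 <= k then Kminus_coef `|k|%N else 0).

(* K^+(C^2 z_i). *)
Definition KplusC2 i : fdist n V :=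
  in_var i (fun k => if k <= 0 then Cpow (2 * k) \o Kplus_coef `|k|%N else 0).

Definition Kfull i : fdist n V := Kminus i ** KplusC2 i.

(* \delta(C^2 z_i / z_j). *)
Definition deltaCC i j : fdist n V := in_ratio i j (fun k => Cpow (2 * k)).

(* C^2 z_i. *)
Definition C2var i : fdist n V := fconst (Cpow 2) ** var i.

(* G(z_i / z_j). *)
Definition Gser i j : fdist n V :=
  in_ratio i j
    (fun k => if 0 <= k then (fun v => Gcoef `|k|%N *: v) else 0).

End Variables.

Definition Xker : fdist 3 V :=
  let z1 := var 0 in let z2 := var 1 in let z3 := var 2 in
  let d := var_inv 0 ** var_inv 1 ** var_inv 2 in
  (z1 + z2) ** (z3 ** z3 - z1 ** z2) ** d ** Gser 1 2
  + (z2 + z3) ** (z1 ** z1 - z2 ** z3) ** d ** Gser 0 1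
  + (z3 + z1) ** (z2 ** z2 - z3 ** z1) ** d.

Definition rel_EE : Prop :=
  let z := var 0 : fdist 2 V in let w := var 1 : fdist 2 V in
  gfun z w ** Ecur 0 ** Ecur 1 + gfun w z ** Ecur 1 ** Ecur 0
  = (kappa q 1)^-1 *: (gfun z w ** deltaCC 0 1 ** Kfull 0
                       + gfun w z ** deltaCC 1 0 ** Kfull 1).

Definition rel_KK_same : Prop :=
  (Kplus 0 ** Kplus 1 = Kplus 1 ** Kplus 0 :> fdist 2 V) /\
  (Kminus 0 ** Kminus 1 = Kminus 1 ** Kminus 0 :> fdist 2 V).

Definition rel_KK_opp : Prop :=
  let z := var 0 : fdist 2 V in let w := var 1 : fdist 2 V in
  let C2w := C2var 1 in
  gfun z w ** gfun z C2w ** Kplus 0 ** Kminus 1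
  = gbar z w ** gbar z C2w ** Kminus 1 ** Kplus 0.

Definition rel_KE : Prop :=
  let z := var 0 : fdist 2 V in let w := var 1 : fdist 2 V in
  (gfun z w ** Kplus 0 ** Ecur 1 = gbar z w ** Ecur 1 ** Kplus 0) /\
  (gfun z w ** Kminus 0 ** Ecur 1 = gbar z w ** Ecur 1 ** Kminus 0).

Definition rel_Serre : Prop :=
  fSym (var 1 ** var_inv 2 ** fbracket (Ecur 0) (fbracket (Ecur 1) (Ecur 2)))
  = fSym (Xker ** ((kappa q 1)^-1 *:
            (deltaCC 0 2 ** Kminus 0 ** Ecur 1 ** Kplus 2))) :> fdist 3 V.

Record is_Kmodule : Prop := MkKmodule {
  Kmod_graded : exists pr : int -> {linear V -> V},
    [/\ bounded_grading pr,
        forall m, has_degree pr (opE X m) m,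
        forall r : int, r != 0 -> has_degree pr (opH X r) r
      & has_degree pr (opC X) 0];
  Kmod_CCinv : cancel (opC X) (opCinv X) /\ cancel (opCinv X) (opC X);
  Kmod_C_central :
    (forall m v, opC X (opE X m v) = opE X m (opC X v)) /\
    (forall (r : int) v, r != 0 -> opC X (opH X r v) = opH X r (opC X v));
  Kmod_EE : rel_EE;
  Kmod_KK_same : rel_KK_same;
  Kmod_KK_opp : rel_KK_opp;
  Kmod_KE : rel_KE;
  Kmod_Serre : rel_Serre }.

Definition has_level (l : F) : Prop := forall v, opC X v = l *: v.

End Relations.

Section Heisenberg.
Context (F : fieldType) (q : 'I_3 -> F) (V : lmodType F).
Implicit Types (k : F) (H : int -> {linear V -> V}) (vac : V).

(* V is a module over the Heisenberg algebra H_k (H 0 is irrelevant). *)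
Record is_Heisenberg k H : Prop := MkHeisenberg {
  Heis_comm : forall (r s : int) v, 0 < r -> s != 0 ->
    H r (H s v) - H s (H r v)
    = - (if r + s == 0 then kappa q r * ((1 + k ^ (2 * r)) / r%:~R) else 0)
      *: v;
  Heis_comm_neg : forall (r s : int) v, r < 0 -> s < 0 ->
    H r (H s v) = H s (H r v) }.

Definition Fock_index : set (seq nat) :=
  [set s | sorted geq s && (0%N \notin s)].

Definition Fock_monomial H vac (s : seq nat) : V :=
  foldr (fun r => H (- r%:Z)) vac s.

(* V is the Fock module of H_k. Being generated by vac and free over            *)
(* C[H_r]_(r<0) means that the monomials in the (commuting) H_r, r < 0, applied *)
(* to vac form a basis of V.                                                    *)
Record is_Fock k H vac : Prop := MkFock {
  Fock_Heis : is_Heisenberg k H;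
  Fock_vac : forall r : int, 0 < r -> H r vac = 0;
  Fock_basis : forall v, exists! f : seq nat -> F,
    [/\ finite_set [set s | f s != 0],
        [set s | f s != 0] `<=` Fock_index
      & v = \sum_(s \in Fock_index) f s *: Fock_monomial H vac s] }.

(* The assignment E(z) |-> 0, K^+-(z) |-> K^+-(z), C |-> k. *)
Definition Heisenberg_Koperators k H : Koperators V :=
  {| opE := fun _ => (\0 : {linear V -> V});
     opH := H;
     opC := (k *: idfun : {linear V -> V});
     opCinv := (k^-1 *: idfun : {linear V -> V}) |}.

End Heisenberg.

(* Main.v *)
(** On the Fock module C acts by k = s_c^-1, so C^2 = q_c^-1.

    As E acts by 0, the relation of E with K and the left-hand sides of the two
    others vanish, and so does the right-hand side of the Serre relation. In the
    quadratic relation for E, the factor z - q_c w of g(z,w) annihilates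
    delta(q_c^-1 z/w).

    Since q_1 q_2 q_3 = 1, kappa_r = sum_i q_i^-r - sum_i q_i^r, so
    K^+(z) K^-(w) = c(w/z) K^-(w) K^+(z), where the logarithmic derivative
    x c'(x) / c(x) is the sum over r > 0 of
    (sum_i q_i^r - sum_i q_i^-r) (1 + k^2r) x^r.
    Hence c(x) = gbar(1,x) gbar(1,C^2 x) / (g(1,x) g(1,C^2 x)). Exponentials are only
    handled through the recursions given by their logarithmic derivatives.

    The grading gives the monomial in H_-n, n in s, applied to the vacuum the degree
    - sum s. *)

Require Import Defs.
From HB Require Import structures.
From mathcomp Require Import all_boot all_order all_algebra.
From mathcomp Require Import zify ring.
From mathcomp Require Import boolp classical_sets functions cardinality fsbigop.
From mathcomp Require Import reals sequences exp trigo.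

Set Implicit Arguments.
Unset Strict Implicit.
Unset Printing Implicit Defensive.

Import Order.TTheory GRing.Theory Num.Theory.

Local Open Scope ring_scope.
Local Open Scope fdist_scope.

(** * Exponentials of commuting operators *)

(** Both sides run over the pairs with [r + t + 1 < m], a condition symmetric in [r] and [t]. *)
Lemma exchange_sum_triangle (M : nmodType) (m : nat) (f : nat -> nat -> M) :
  \sum_(r < m) \sum_(t < m - r.+1) f r t
  = \sum_(t < m) \sum_(r < m - t.+1) f r t.
Proof.
have widen (h : nat -> nat -> M) : \sum_(r < m) \sum_(t < m - r.+1) h r t
    = \sum_(r < m) \sum_(t < m) if (r + t < m.-1)%N then h r t else 0.
  apply: eq_bigr => r _.
  rewrite (big_ord_widen m (h r)) ?leq_subr// big_mkcond /=.
  by apply: eq_bigr => t _; congr (if _ then _ else _); lia.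
rewrite widen (widen (fun t r => f r t)) exchange_big /=.
by apply: eq_bigr => t _; apply: eq_bigr => r _; rewrite addnC.
Qed.

Section ExpCoef.
Variables (F : numFieldType) (V : lmodType F) (A : nat -> {linear V -> V}).

Lemma pow_coefS_apply k m v :
  pow_coef A k.+1 m v = \sum_(r < m) A r.+1 (pow_coef A k (m - r.+1) v).
Proof. by rewrite /= fct_sumE. Qed.

Lemma pow_coef_gt k m v : (m < k)%N -> pow_coef A k m v = 0.
Proof.
elim: k m => // k IH m ltmk; rewrite pow_coefS_apply big1// => r _.
by rewrite IH ?linear0//; have := ltn_ord r; lia.
Qed.

(** The series has no constant term, so powers beyond the [m]-th do not reach [x ^ m]; one bound can
    then serve several coefficients. *)
Lemma exp_coefE k m v : (m < k)%N ->
  exp_coef A m v = \sum_(j < k) (j`!%:R : F)^-1 *: pow_coef A j m v.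
Proof.
move=> ltmk; rewrite /exp_coef fct_sumE.
rewrite (big_ord_widen k (fun j => ((j`!%:R : F)^-1 *: pow_coef A j m) v))//.
rewrite big_mkcond; apply: eq_bigr => j _ /=; case: ltnP => // ltmj.
by rewrite pow_coef_gt ?scaler0.
Qed.

Lemma pow_coef_linear k m a u v :
  pow_coef A k m (a *: u + v) = a *: pow_coef A k m u + pow_coef A k m v.
Proof.
elim: k m => [|k IH] m; first by rewrite /=; case: eqP => // _; rewrite scaler0 addr0.
rewrite !pow_coefS_apply scaler_sumr -big_split /=; apply: eq_bigr => r _.
by rewrite IH linearP.
Qed.

Lemma exp_coef_linear m : linear (exp_coef A m).
Proof.
move=> a u v; rewrite !(@exp_coefE m.+1)// scaler_sumr -big_split /=.
apply: eq_bigr => j _.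
by rewrite pow_coef_linear scalerDr !scalerA mulrC.
Qed.

Definition exp_lin m : {linear V -> V} :=
  HB.pack (exp_coef A m) (GRing.isLinear.Build F V V *:%R _ (exp_coef_linear m)).

Lemma exp_coefD m u v : exp_coef A m (u + v) = exp_coef A m u + exp_coef A m v.
Proof. exact: (linearD (exp_lin m)). Qed.

Lemma exp_coefZ m a v : exp_coef A m (a *: v) = a *: exp_coef A m v.
Proof. exact: (linearZZ (exp_lin m)). Qed.

Lemma exp_coef_zero m : exp_coef A m 0 = 0.
Proof. exact: (linear0 (exp_lin m)). Qed.

Lemma exp_coef_sum m n (f : 'I_n -> V) :
  exp_coef A m (\sum_(i < n) f i) = \sum_(i < n) exp_coef A m (f i).
Proof. exact: (linear_sum (exp_lin m)). Qed.

Lemma exp_coef0 v : exp_coef A 0 v = v.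
Proof. by rewrite (@exp_coefE 1)// big_ord1 fact0 invr1 scale1r. Qed.

Lemma exp_coef_comm (B : {linear V -> V}) m v :
  (forall r u, B (A r.+1 u) = A r.+1 (B u)) ->
  B (exp_coef A m v) = exp_coef A m (B v).
Proof.
move=> BA.
have powBA k n u : B (pow_coef A k n u) = pow_coef A k n (B u).
  elim: k n => [|k IH] n; first by rewrite /=; case: eqP; rewrite ?linear0.
  by rewrite !pow_coefS_apply linear_sum; apply: eq_bigr => r _; rewrite BA IH.
rewrite !(@exp_coefE m.+1)// linear_sum.
by apply: eq_bigr => j _; rewrite linearZ powBA.
Qed.

Hypothesis commA : forall r s u, A r.+1 (A s.+1 u) = A s.+1 (A r.+1 u).

(** Coefficient of x^m in x d/dx L^(k+1) = (k+1) (x L') L^k, where the [A_r] have to commute. *)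
Lemma pow_coef_euler k m v :
  m%:R *: pow_coef A k.+1 m v
  = k.+1%:R *: \sum_(r < m) r.+1%:R *: A r.+1 (pow_coef A k (m - r.+1) v).
Proof.
elim: k m => [|k IH] m.
  rewrite pow_coefS_apply scaler_sumr scale1r; apply: eq_bigr => r _ /=.
  case: eqP => [e|_]; last by rewrite linear0 !scaler0.
  by congr (_%:R *: _); have := ltn_ord r; lia.
rewrite pow_coefS_apply scaler_sumr.
(* Leibniz rule: [m] splits as [r.+1] plus [m - r.+1], and the second part differentiates the
   remaining power, known by induction. *)
under eq_bigr => r _.
  rewrite -[m in m%:R](subnKC (ltn_ord r)).
  rewrite natrD scalerDl -[X in _ + X]linearZ /= IH linearZ /=.
over.
rewrite big_split /= -[k.+2]add1n natrD scalerDl scale1r; congr (_ + _).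
rewrite -scaler_sumr; congr (_ *: _).
transitivity (\sum_(r < m) \sum_(t < m - r.+1) A r.+1 (t.+1%:R *:
    A t.+1 (pow_coef A k (m - r.+1 - t.+1) v))).
  by apply: eq_bigr => r _; exact: linear_sum.
rewrite (exchange_sum_triangle m (fun r t => A r.+1 (t.+1%:R *:
  A t.+1 (pow_coef A k (m - r.+1 - t.+1) v)))).
apply: eq_bigr => t _; rewrite fct_sumE linear_sum scaler_sumr.
by apply: eq_bigr => r _; rewrite linearZ /= commA subnAC.
Qed.

(** Weighting [pow_coef_euler] by 1/(k+1)! gives x d/dx exp L = (x L') exp L, the recursion behind
    the exchange formulas below. *)
Lemma exp_coef_euler m v :
  m%:R *: exp_coef A m v
  = \sum_(r < m) r.+1%:R *: A r.+1 (exp_coef A (m - r.+1) v).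
Proof.
case: m => [|m]; first by rewrite big_ord0 scale0r.
have E (k : 'I_m.+1) :
    m.+1%:R *: (((lift ord0 k)`!%:R : F)^-1 *: pow_coef A (lift ord0 k) m.+1 v)
    = \sum_(r < m.+1) (k`!%:R : F)^-1 *:
        (r.+1%:R *: A r.+1 (pow_coef A k (m.+1 - r.+1) v)).
  rewrite scalerA mulrC -scalerA lift0 pow_coef_euler scalerA -scaler_sumr.
  by rewrite factS natrM invfM mulrAC mulVf ?pnatr_eq0// mul1r.
rewrite (@exp_coefE m.+2)// big_ord_recl [pow_coef _ ord0 _ _]/=.
rewrite scaler0 add0r scaler_sumr (eq_bigr _ (fun k _ => E k)).
rewrite exchange_big /=; apply: eq_bigr => r _.
rewrite (@exp_coefE m.+1); last by have := ltn_ord r; lia.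
rewrite linear_sum scaler_sumr; apply: eq_bigr => k _.
by rewrite [in RHS]linearZ /= !scalerA mulrC.
Qed.

End ExpCoef.

(** * Exchanging two exponentials *)

Section LogDerivative.
Variable F : numFieldType.
Implicit Types (l c d : nat -> F) (a : F).

(* For C(x) = \sum_n c_n x^n and L(x) = \sum_(r > 0) l_r x^r, this says          *)
(* x C'(x) = L(x) C(x) and C(0) = 1.                                             *)
Definition log_deriv l c : Prop := c 0%N = 1 /\
  forall m, m%:R * c m = \sum_(r < m) l r.+1 * c (m - r.+1)%N.

Lemma log_deriv_uniq l c d : log_deriv l c -> log_deriv l d -> c =1 d.
Proof.
move=> [c0 Ec] [d0 Ed] m; elim/ltn_ind: m => -[|m] IH; first by rewrite c0 d0.
apply: (@mulfI _ m.+1%:R); first by rewrite pnatr_eq0.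
rewrite Ec Ed; apply: eq_bigr => r _; congr (_ * _); apply: IH.
by have := ltn_ord r; lia.
Qed.

Lemma eq_log_deriv l l' c :
  (forall r, l r.+1 = l' r.+1) -> log_deriv l c -> log_deriv l' c.
Proof.
move=> ll' [c0 Ec]; split=> // m; rewrite Ec.
by apply: eq_bigr => r _; rewrite ll'.
Qed.

Lemma log_deriv1 : log_deriv (fun=> 0) (fun j => (j == 0%N)%:R).
Proof.
split=> // -[|m]; first by rewrite big_ord0 mul0r.
by rewrite mulr0 big1// => r _; rewrite mul0r.
Qed.

(** The solution is the exponential of the sum of (l_r / r) x^r; viewing scalars as operators on
    [F^o] makes [exp_coef_euler] applicable. *)
Lemma log_deriv_exists l : exists c, log_deriv l c.
Proof.
pose sc (a : F) : {linear F^o -> F^o} := ( a *: idfun : {linear F^o -> F^o}).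
pose A r : {linear F^o -> F^o} := sc (l r / r%:R).
have commA r s u : A r.+1 (A s.+1 u) = A s.+1 (A r.+1 u).
  by rewrite /A /= /GRing.scale /= mulrCA.
exists (fun m => @exp_coef F F^o (fun r => A r) m 1); split.
  exact: (exp_coef0 A).
move=> m; rewrite [LHS](exp_coef_euler commA); apply: eq_bigr => r _.
rewrite /A /= /GRing.scale /= mulrA; congr (_ * _).
by rewrite mulrC divfK ?pnatr_eq0.
Qed.

(* Coefficients of (1 - a x) C(x). *)
Definition mul_lin a c : nat -> F :=
  fun j => c j - a * (if j is i.+1 then c i else 0).

(** Coefficient of x^(m+1) in (a x / (1 - a x)) (1 - a x) C(x) = a x C(x). *)
Lemma sum_mul_lin a c m : \sum_(r < m.+1) a ^+ r.+1 * mul_lin a c (m - r) = a * c m.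
Proof.
elim: m => [|m IH]; first by rewrite big_ord1 /mul_lin mulr0 subr0 expr1.
rewrite big_ord_recl subn0 expr1.
under eq_bigr => r _ do rewrite lift0 subSS exprS -mulrA.
by rewrite -mulr_sumr IH /mul_lin; ring.
Qed.

(** The factor 1 - a x contributes its own logarithmic derivative, minus the sum of a^r x^r. *)
Lemma log_deriv_mul_lin a l c :
  log_deriv l c -> log_deriv (fun r => l r - a ^+ r) (mul_lin a c).
Proof.
move=> [c0 Ec]; split=> [|[|m]]; first by rewrite /mul_lin mulr0 subr0.
  by rewrite big_ord0 mul0r.
under eq_bigr => r _ do rewrite mulrBl.
rewrite sumrB [X in _ = _ - X](sum_mul_lin a c m) {1}/mul_lin mulrBr Ec.
under [X in _ = X - _]eq_bigr => r _ do rewrite /mul_lin mulrBr.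
rewrite sumrB -addrA -opprD; congr (_ - _).
rewrite mulrCA -[m.+1]addn1 natrD mulrDl mul1r Ec mulrDr; congr (_ + _).
rewrite addn1 big_ord_recr /= subnn mulr0 mulr0 addr0 mulr_sumr.
apply: eq_bigr => r _; rewrite mulrCA; congr (_ * (_ * _)).
by rewrite subSn.
Qed.

Definition mul_lins (s : seq F) c := foldr mul_lin c s.

Lemma log_deriv_mul_lins (s : seq F) l c : log_deriv l c ->
  log_deriv (fun r => l r - \sum_(a <- s) a ^+ r) (mul_lins s c).
Proof.
move=> lc; elim: s => [|a s IH] /=.
  by apply: eq_log_deriv lc => r; rewrite big_nil subr0.
by apply: eq_log_deriv (log_deriv_mul_lin a IH) => r; rewrite big_cons opprD addrA addrAC.
Qed.

(* If L = \sum_(a <- s) a x / (1 - a x) - \sum_(b <- t) b x / (1 - b x), then     *)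
(* C = \prod_(b <- t) (1 - b x) / \prod_(a <- s) (1 - a x).                      *)
Lemma mul_lins_log_deriv (s t : seq F) l c :
    (forall r, l r.+1 = \sum_(a <- s) a ^+ r.+1 - \sum_(b <- t) b ^+ r.+1) ->
  log_deriv l c -> mul_lins s c =1 mul_lins t (fun j => (j == 0%N)%:R).
Proof.
move=> El /(log_deriv_mul_lins s) lc.
have lt := log_deriv_mul_lins t log_deriv1.
apply: log_deriv_uniq (eq_log_deriv _ lc) lt => r.
by rewrite El sub0r addrAC subrr sub0r.
Qed.

End LogDerivative.

(** * Normal ordering of two exponentials *)

Section Exchange.
Variables (F : numFieldType) (V : lmodType F) (A B : nat -> {linear V -> V}).
Variable kp : nat -> F.
Hypothesis commA : forall r s u, A r.+1 (A s.+1 u) = A s.+1 (A r.+1 u).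
Hypothesis commB : forall r s u, B r.+1 (B s.+1 u) = B s.+1 (B r.+1 u).
Hypothesis commAB : forall r s u,
  A r.+1 (B s.+1 u) = B s.+1 (A r.+1 u) + (if r == s then kp r.+1 else 0) *: u.

Local Notation Kp := (exp_coef A).
Local Notation Km := (exp_coef B).

(** As the brackets [A_r, B_s] are scalars, [A_r, K^-(x)] = kp_r x^r K^-(x) for K^-(x) = exp(sum B_s
    x^s). The induction uses the Euler recursion of K^-. *)
Lemma exp_coef_exchange1 r n v : A r.+1 (Km n v) =
  Km n (A r.+1 v) + (if (r < n)%N then kp r.+1 *: Km (n - r.+1)%N v else 0).
Proof.
elim/ltn_ind: n v => -[|n] IH v; first by rewrite !exp_coef0 addr0.
apply: (@scalerI _ _ n.+1%:R); first by rewrite pnatr_eq0.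
rewrite scalerDr -[LHS]linearZ /= !exp_coef_euler// linear_sum /=.
(* [f] collects what arises further inside the exponential, [g] the bracket with [B r.+1] itself.
   For r <= n they sum to n - r and r + 1 times [kp r.+1 *: Km (n - r) v], in total n + 1 times
   it. *)
pose f s := kp r.+1 *: (s.+1%:R *:
  if (r + s.+1 < n.+1)%N then B s.+1 (Km (n.+1 - r.+1 - s.+1) v) else 0).
pose g s := (if s == r then r.+1%:R * kp r.+1 else 0) *: Km (n - r) v.
transitivity (\sum_(s < n.+1) (s.+1%:R *: B s.+1 (Km (n.+1 - s.+1) (A r.+1 v))
    + (f s + g s))).
  apply: eq_bigr => s _; rewrite linearZ /= commAB IH; last first.
    by have := ltn_ord s; lia.
  rewrite (linearD (B s.+1)) /= -addrA 2!scalerDr; congr (_ + (_ + _)).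
    rewrite /f scalerA mulrC -scalerA; congr (_ *: _).
    have -> : (r < n.+1 - s.+1)%N = (r + s.+1 < n.+1)%N by have := ltn_ord s; lia.
    by case: ifP => _; rewrite ?linear0 ?scaler0// linearZ /= subnAC.
  rewrite /g scalerA eq_sym; case: eqP => [->|_]; last by rewrite mulr0 !scale0r.
  by rewrite subSS.
rewrite !big_split /=; congr (_ + _); case: ltnP => [lerm|ltmr]; last first.
  by rewrite scaler0 !big1 ?addr0// => s _; rewrite /g ?/f ?ifF ?scaler0 ?scale0r//;
    have := ltn_ord s; lia.
have -> : \sum_(s < n.+1) f s = kp r.+1 *: ((n - r)%:R *: Km (n - r) v).
  rewrite exp_coef_euler// /f -scaler_sumr; congr (_ *: _).
  rewrite (big_ord_widen n.+1 (fun s =>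
    s.+1%:R *: B s.+1 (Km (n - r - s.+1) v))) ?[RHS]big_mkcond /=; last by lia.
  apply: eq_bigr => s _; rewrite subSS.
  have -> : (r + s.+1 < n.+1)%N = (s < n - r)%N by lia.
  by case: ifP; rewrite ?scaler0.
have -> : \sum_(s < n.+1) g s = kp r.+1 *: (r.+1%:R *: Km (n - r) v).
  rewrite (bigD1 (Ordinal lerm))//= big1 ?addr0 => [|s /negPf nr].
    by rewrite /g eqxx scalerA mulrC.
  by rewrite /g -val_eqE /= in nr *; rewrite nr scale0r.
rewrite -scalerDr -scalerDl -natrD addnS subnK// subSS.
by rewrite !scalerA mulrC.
Qed.

(** The coefficient of the normal-ordered product that is paired with x^j. The test is there because
    truncated subtraction would turn negative indices into 0. *)
Definition shifted_normal m n j v : V :=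
  if (j <= m)%N && (j <= n)%N then Km (n - j) (Kp (m - j) v) else 0.

Lemma exp_coef_euler_r m v :
  m%:R *: Kp m v = \sum_(r < m) r.+1%:R *: Kp (m - r.+1) (A r.+1 v).
Proof.
rewrite exp_coef_euler//; apply: eq_bigr => r _; congr (_ *: _).
by apply: exp_coef_comm => s u; rewrite commA.
Qed.

(** Induction on [m]: the Euler recursion takes one [A_r] out of K^+, and [exp_coef_exchange1] moves
    it across K^-. The terms with [j] beyond [m] or [n] are zero, so one [N] serves the whole
    induction. *)
Lemma exp_coef_exchange c N m n v :
    log_deriv (fun r => r%:R * kp r) c -> (m < N)%N -> (n < N)%N ->
  Kp m (Km n v) = \sum_(j < N) c j *: shifted_normal m n j v.
Proof.
move=> [c0 Ec]; elim/ltn_ind: m n v => -[|m] IH n v ltmN ltnN.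
  rewrite exp_coef0; case: N IH ltmN ltnN => // N _ _ _.
  rewrite big_ord_recl big1 /shifted_normal /= => [|j _]; last by rewrite scaler0.
  by rewrite c0 scale1r subn0 exp_coef0 addr0.
apply: (@scalerI _ _ m.+1%:R); first by rewrite pnatr_eq0.
rewrite exp_coef_euler_r.
(* In [P] the operator [A r.+1] has reached the vector; [Q] comes from its bracket with K^-. *)
pose P r j := r.+1%:R *: (c j *: shifted_normal (m.+1 - r.+1) n j (A r.+1 v)).
pose Q r j := (r.+1%:R * kp r.+1 * c j) *: shifted_normal m.+1 n (r + j).+1 v.
transitivity (\sum_(r < m.+1) (\sum_(j < N) P r j + \sum_(j < N) Q r j)).
  apply: eq_bigr => r _; rewrite exp_coef_exchange1 exp_coefD.
  rewrite IH; try by have := ltn_ord r; lia.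
  rewrite scalerDr scaler_sumr; congr (_ + _).
  case: ltnP => [ltrn|lenr]; last first.
    rewrite exp_coef_zero scaler0 big1// => j _; rewrite /Q /shifted_normal.
    by rewrite ifF ?scaler0//; lia.
  rewrite exp_coefZ IH; try by have := ltn_ord r; lia.
  rewrite !scaler_sumr; apply: eq_bigr => j _; rewrite !scalerA /Q.
  congr (_ *: _); rewrite /shifted_normal.
  have -> : (j <= m.+1 - r.+1)%N = ((r + j).+1 <= m.+1)%N by have := ltn_ord r; lia.
  have -> : (j <= n - r.+1)%N = ((r + j).+1 <= n)%N by lia.
  by rewrite -!subnDA addSn.
rewrite big_split /= scaler_sumr.
(* The factor m + 1 splits as (m + 1 - j) + j: the first part matches [P] by the Euler recursion of
   [Kp (m.+1 - j)], the second matches [Q] by the recursion of [c j]. *)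
transitivity (\sum_(j < N) ((m.+1 - j)%:R * c j) *: shifted_normal m.+1 n j v
   + \sum_(j < N) (j%:R * c j) *: shifted_normal m.+1 n j v); last first.
  rewrite -big_split; apply: eq_bigr => j _ /=; rewrite -scalerDl -mulrDl scalerA.
  rewrite /shifted_normal; case: leqP => lejm /=; last by rewrite !scaler0.
  by rewrite -natrD subnK.
congr (_ + _).
  rewrite exchange_big; apply: eq_bigr => j _ /=; rewrite /P mulrC -scalerA.
  under eq_bigr => r _ do rewrite scalerA mulrC -scalerA.
  rewrite -scaler_sumr; congr (_ *: _); rewrite /shifted_normal.
  case: (leqP j n) => lejn; last first.
    by rewrite !andbF scaler0 big1// => r _; rewrite andbF scaler0.
  case: (leqP j m.+1) => lejm; last first.
    rewrite scaler0 big1// => r _; rewrite ifF ?scaler0//.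
    by have := ltn_ord r; lia.
  rewrite -[RHS]exp_coefZ exp_coef_euler_r exp_coef_sum.
  rewrite (big_ord_widen m.+1 (fun r => Km (n - j) (r.+1%:R *:
    Kp (m.+1 - j - r.+1) (A r.+1 v)))) ?leq_subr// [RHS]big_mkcond /=.
  apply: eq_bigr => r _.
  have -> : (j <= m.+1 - r.+1)%N = (r < m.+1 - j)%N by have := ltn_ord r; lia.
  rewrite andbT; case: ifP => _; last by rewrite scaler0.
  by rewrite [RHS]exp_coefZ subnAC.
(* Terms gained or lost are zero: their shift [(r + j).+1] exceeds [m.+1]. *)
transitivity (\sum_(r < N) \sum_(j < N - r.+1) Q r j).
  rewrite (big_ord_widen N (fun r => \sum_(j < N) Q r j)) 1?ltnW// big_mkcond /=.
  apply: eq_bigr => r _; rewrite (@big_ord_widen _ _ _ (N - r.+1) N (Q r)) ?leq_subr//.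
  rewrite [RHS]big_mkcond /=; case: ifP => ltrm; last first.
    rewrite big1// => j _; case: ifP => // _; rewrite /Q /shifted_normal.
    by rewrite ifF ?scaler0//; lia.
  apply: eq_bigr => j _; case: ifP => // ltjr; rewrite /Q /shifted_normal.
  by rewrite ifF ?scaler0//; lia.
under [RHS]eq_bigr => j _ do rewrite Ec scaler_suml.
rewrite /Q.
(* Here [l] is the total shift r + j + 1. *)
pose h r l := (r.+1%:R * kp r.+1 * c (l - r.+1)%N) *: shifted_normal m.+1 n l v.
transitivity (\sum_(r < N) \sum_(l < N) if (r < l)%N then h r l else 0); last first.
  rewrite exchange_big; apply: eq_bigr => l _ /=.
  rewrite -[RHS]/(\sum_(r < l) h r l) (@big_ord_widen _ _ _ l N (h^~ l)) 1?ltnW//.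
  by rewrite [RHS]big_mkcond.
apply: eq_bigr => r _.
rewrite -(big_mkord xpredT (fun l => if (r < l)%N then h r l else 0)).
rewrite (@big_cat_nat _ _ _ r.+1)//= [X in _ = X + _]big1_seq ?add0r => [|l]; last first.
  by rewrite mem_index_iota => /andP[_] H; rewrite ifF//; lia.
rewrite [RHS](big_addn 0 N r.+1) big_mkord; apply: eq_bigr => j _.
rewrite ifT ?/h; last by lia.
by rewrite addnK addnS addnC.
Qed.

End Exchange.

(** * Formal distributions *)

Lemma fsumTE (M : nmodType) (I : choiceType) (s : seq I) (f : I -> M) :
  uniq s -> (forall i, i \notin s -> f i = 0) ->
  \sum_(i \in [set: I]) f i = \sum_(i <- s) f i.
Proof.
move=> us f0; rewrite (fsbigE s)//; last by move=> i _; exact: f0.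
by apply: eq_bigl => i; rewrite in_setT.
Qed.

Section FormalDistributionCalculus.
Variables (F : fieldType) (V : lmodType F) (n : nat).
Implicit Types (f g h : fdist n V) (a b : expo n) (i j : 'I_n).
Implicit Types (p r : seq (F * expo n)).

Lemma fmul_single b f g a v :
  (forall b', b' != b -> f b' (g (a - b') v) = 0) ->
  (f ** g) a v = f b (g (a - b) v).
Proof.
move=> H; rewrite /fmul (@fsumTE _ _ [:: b])// ?big_seq1// => b'.
by rewrite inE; exact: H.
Qed.

Lemma fmul_eq0 f g a v :
  (forall b, f b (g (a - b) v) = 0) -> (f ** g) a v = 0.
Proof. by move=> H; rewrite (@fmul_single 0). Qed.

(* Coefficients of formal distributions are arbitrary maps; this is what products *)
(* need in place of their linearity.                                             *)
Definition kills0 f : Prop := forall a, f a 0 = 0.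

Lemma kills0M f g : kills0 f -> kills0 g -> kills0 (f ** g).
Proof. by move=> f0 g0 a; apply: fmul_eq0 => b; rewrite g0 f0. Qed.

Lemma kills0D f g : kills0 f -> kills0 g -> kills0 (f + g).
Proof. by move=> f0 g0 a; rewrite /= -[LHS]/(f a 0 + g a 0) f0 g0 addr0. Qed.

Lemma kills0B f g : kills0 f -> kills0 g -> kills0 (f - g).
Proof. by move=> f0 g0 a; rewrite /= -[LHS]/(f a 0 - g a 0) f0 g0 subr0. Qed.

Lemma kills0_in_var i (f_ : int -> V -> V) :
  (forall k, f_ k 0 = 0) -> kills0 (in_var i f_).
Proof. by move=> f0 a; rewrite /in_var; case: eqP. Qed.

Lemma kills0_in_ratio i j (f_ : int -> V -> V) :
  (forall k, f_ k 0 = 0) -> kills0 (in_ratio i j f_).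
Proof. by move=> f0 a; rewrite /in_ratio; case: eqP. Qed.

Lemma kills0_var i : kills0 (var i).
Proof. by apply: kills0_in_var => l; case: eqP. Qed.

Lemma kills0_var_inv i : kills0 (var_inv i).
Proof. by apply: kills0_in_var => l; case: eqP. Qed.

Lemma kills0_var_sub i j (c : F) : kills0 (var i - c *: var j).
Proof.
apply: kills0B; first exact: kills0_var.
by move=> a; rewrite -[LHS]/(c *: var j a 0) kills0_var scaler0.
Qed.

Lemma kills0_prod_var_sub i j (c : 'I_3 -> F) :
  kills0 (\big[@fmul F V n/fone]_(l < 3) (var i - c l *: var j)).
Proof.
elim/big_ind: _ => [a|f g|l _]; [|exact: kills0M|exact: kills0_var_sub].
by rewrite /fone /fconst; case: eqP.
Qed.

Lemma fmulr0 f : kills0 f -> f ** (0 : fdist n V) = 0.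
Proof. by move=> f0; apply/funext => a; apply/funext => v; exact: fmul_eq0. Qed.

Lemma fmul0r f : (0 : fdist n V) ** f = 0.
Proof. by apply/funext => a; apply/funext => v; exact: fmul_eq0. Qed.

(** Scalar Laurent polynomials as lists of monomials, equal exponents being added. Multiplying by
    one is a finite sum whatever the other factor, so such products reassociate freely. *)
Definition laurent p : fdist n V :=
  fun a v => (\sum_(t <- p | t.2 == a) t.1) *: v.

Lemma laurent_mul p h a v :
  (laurent p ** h) a v = \sum_(t <- p) t.1 *: h (a - t.2) v.
Proof.
rewrite /fmul (@fsumTE _ _ (undup (unzip2 p))) ?undup_uniq//; last first.
  move=> b; rewrite mem_undup => bp; rewrite /laurent big_seq_cond big1 ?scale0r//.
  by move=> t /andP[tp /eqP tb]; case/negP: bp; rewrite -tb map_f.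
transitivity (\sum_(b <- undup (unzip2 p))
    \sum_(t <- p | t.2 == b) t.1 *: h (a - t.2) v).
  apply: eq_bigr => b _; rewrite /laurent scaler_suml.
  by apply: eq_bigr => t /eqP ->.
rewrite (exchange_big_dep xpredT)//= big_seq [RHS]big_seq.
apply: eq_bigr => t tp; rewrite big_mkcond (bigD1_seq t.2) ?undup_uniq//=; last first.
  by rewrite mem_undup map_f.
by rewrite eqxx big1 ?addr0// => b /negPf; rewrite eq_sym => ->.
Qed.

Definition laurent_prod p r : seq (F * expo n) :=
  [seq (t.1 * u.1, t.2 + u.2) | t <- p, u <- r].

Lemma laurent_mulA p r h :
  laurent p ** (laurent r ** h) = laurent (laurent_prod p r) ** h.
Proof.
apply/funext => a; apply/funext => v; rewrite !laurent_mul big_allpairs_dep /=.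
apply: eq_bigr => t _; rewrite laurent_mul scaler_sumr; apply: eq_bigr => u _.
by rewrite scalerA opprD addrA.
Qed.

Lemma laurentM p r : laurent p ** laurent r = laurent (laurent_prod p r).
Proof.
apply/funext => a; apply/funext => v; rewrite laurent_mul /laurent.
rewrite [in RHS]big_mkcond big_allpairs_dep /= scaler_suml; apply: eq_bigr => t _.
rewrite scalerA mulr_sumr; congr (_ *: _); rewrite big_mkcond /=.
apply: eq_bigr => u _; congr (if _ then _ else _).
by rewrite [RHS]eq_sym [in RHS]addrC -[RHS]subr_eq eq_sym.
Qed.

Lemma fone_laurent : fone = laurent [:: (1, 0)].
Proof.
apply/funext => a; apply/funext => v; rewrite /fone /fconst /laurent.
rewrite big_cons big_nil /= eq_sym; case: eqP => _; last by rewrite scale0r.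
by rewrite addr0 scale1r.
Qed.

Lemma mul1fd h : fone ** h = h.
Proof.
apply/funext => a; apply/funext => v.
by rewrite fone_laurent laurent_mul big_seq1 subr0 scale1r.
Qed.

Lemma unit_expo_mulz i (m : int) j : (unit_expo i *~ m) j = if j == i then m else 0.
Proof.
have ffE : (unit_expo i *~ m) j = unit_expo i j *~ m.
  by case: m => m; rewrite /intmul ?ffunMnE// ffunE ffunMnE.
by rewrite ffE ffunE; case: eqP => _; rewrite ?mul0rz// intz.
Qed.

Lemma var_subE i j (c : F) :
  var i - c *: var j = laurent [:: (1, unit_expo i); (- c, unit_expo j)].
Proof.
have varE l a v : var l a v = if a == unit_expo l then v else 0 :> V.
  rewrite /var /in_var; case: (a =P unit_expo l) => [->|ne].
    by rewrite ffunE eqxx mulr1z eqxx.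
  case: eqP => // E; case: eqP => // E1; case: ne.
  by rewrite E E1.
apply/funext => a; apply/funext => v.
rewrite -[LHS]/(var i a v - c *: var j a v) !varE /laurent !big_cons big_nil /=.
rewrite ![_ == a]eq_sym.
by case: eqP => _; case: eqP => _;
  rewrite ?scaler0 ?addr0 ?subr0 ?sub0r ?scale0r ?scalerDl ?scaleNr ?scale1r.
Qed.

Lemma var_sub_mul i j (c : F) h a v :
  ((var i - c *: var j) ** h) a v = h (a - unit_expo i) v - c *: h (a - unit_expo j) v.
Proof.
by rewrite var_subE laurent_mul !big_cons big_nil /= scale1r addr0 scaleNr.
Qed.

Lemma prod_var_sub_mul i j (c : 'I_3 -> F) h :
  (\big[@fmul F V n/fone]_(l < 3) (var i - c l *: var j)) ** h
  = (var i - c 0 *: var j) ** (var i - c 1 *: var j) ** (var i - c 2 *: var j) ** h.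
Proof.
have -> : c 1 = c (lift ord0 ord0) by congr c; exact: val_inj.
have -> : c 2 = c (lift ord0 (lift ord0 ord0)) by congr c; exact: val_inj.
rewrite !big_ord_recl big_ord0 -[in RHS](mul1fd h) fone_laurent !var_subE.
by rewrite !laurentM -!laurent_mulA.
Qed.

(* The hypothesis says that (z_i - c_l z_j) h = 0. *)
Lemma prod_var_sub_mul0 i j (c : 'I_3 -> F) l h :
  (forall a v, h (a - unit_expo i) v = c l *: h (a - unit_expo j) v) ->
  (\big[@fmul F V n/fone]_(m < 3) (var i - c m *: var j)) ** h = 0.
Proof.
pose vanishes g :=
  forall a v, g (a - unit_expo i) v = c l *: g (a - unit_expo j) v.
rewrite prod_var_sub_mul -/(vanishes h) => h0.
(* Linear factors commute, so those applied before the factor with root [c l] preserve the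
   vanishing; those applied after it act on 0. *)
have vanishesM (b : F) g : vanishes g -> vanishes ((var i - b *: var j) ** g).
  move=> g0 a v; rewrite !var_sub_mul (g0 (a - unit_expo i)).
  rewrite [a - unit_expo i - unit_expo j]addrAC (g0 (a - unit_expo j)).
  by rewrite scalerBr !scalerA [b * _]mulrC.
have mul0 (b : F) : (var i - b *: var j) ** (0 : fdist n V) = 0.
  by apply: fmulr0; exact: kills0_var_sub.
have mul_root g : vanishes g -> (var i - c l *: var j) ** g = 0.
  move=> g0; apply/funext => a; apply/funext => v.
  by rewrite var_sub_mul g0 subrr.
case: (unliftP 0 l) => [l'|] lE; last first.
  have -> : c 0 = c l by rewrite lE.
  by rewrite mul_root//; do 2!apply: (vanishesM).
case: (unliftP 0 l') => [l2|] l'E; last first.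
  have -> : c 1 = c l by congr c; rewrite lE l'E; exact: val_inj.
  by rewrite [X in _ ** X]mul_root ?mul0//; exact: vanishesM.
have l2E : c 2 = c l by congr c; rewrite lE l'E (ord1 l2); exact: val_inj.
by rewrite l2E mul_root// !mul0.
Qed.

End FormalDistributionCalculus.

(** * The relations on a Heisenberg module *)

Section TwoVariables.
Variables (F : numFieldType) (V : lmodType F).
Implicit Types (a : expo 2) (i j : 'I_2) (N : fdist 2 V) (c : nat -> F).

Local Notation e0 := (unit_expo (0 : 'I_2)).
Local Notation e1 := (unit_expo (1 : 'I_2)).

(** Only b = a_i e_i contributes, and with just two variables a - b is then a multiple of e_j for
    every a. *)
Lemma in_var_mul i j (f g : int -> V -> V) a v : i != j ->
  (forall k, f k 0 = 0) ->
  (in_var i f ** in_var j g) a v = f (a i) (g (a j) v).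
Proof.
move=> ij f0; rewrite (@fmul_single _ _ _ (unit_expo i *~ a i)) => [|b nb].
  have bi : (unit_expo i *~ a i) i = a i by rewrite unit_expo_mulz eqxx.
  have bj : (a - unit_expo i *~ a i) j = a j.
    by rewrite !ffunE unit_expo_mulz eq_sym (negPf ij) subr0.
  rewrite /in_var bi eqxx bj ifT//; apply/eqP/ffunP => l.
  rewrite !ffunE !unit_expo_mulz; case: (l =P j) => [->|/eqP lj].
    by rewrite eq_sym (negPf ij) subr0.
  suff -> : l = i by rewrite eqxx subrr.
  by case: l i j lj ij {f0 bi bj} => -[|[|//]] ? -[[|[|//]] ?] -[[|[|//]] ?] //= _ _;
    exact: val_inj.
rewrite /in_var; case: (b =P _) => // bE; rewrite ifF ?f0//.
apply/negP => /eqP /(congr1 (fun x : expo 2 => x i)).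
rewrite !ffunE unit_expo_mulz (negPf ij) => /eqP; rewrite subr_eq0 => /eqP abi.
by case/negP: nb; rewrite abi -bE.
Qed.

(* The product of c(z_1 / z_0), for c(x) = \sum_j c_j x^j, with N; the sum is      *)
(* truncated at the order from which N vanishes, if it is a power series in z_1. *)
Definition ratio_mul c N : fdist 2 V :=
  fun a v => \sum_(j < `|a 1|.+1) c j *: N (a + (e0 - e1) *+ j) v.

Definition power_series1 N := forall a v, a 1 < 0 -> N a v = 0.

Lemma shift_expo0 a (j : nat) : (a + (e0 - e1) *+ j) 0 = a 0 + j%:Z.
Proof. by rewrite ffunE ffunMnE !ffunE /= subr0; congr (_ + _); exact: natz. Qed.

Lemma shift_expo1 a (j : nat) : (a + (e0 - e1) *+ j) 1 = a 1 - j%:Z.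
Proof.
by rewrite ffunE ffunMnE !ffunE /= sub0r mulNrn; congr (_ - _); exact: natz.
Qed.

Lemma ratio_mul_neg c N a v : power_series1 N -> a 1 < 0 -> ratio_mul c N a v = 0.
Proof.
move=> N0 a0; apply: big1 => j _; rewrite N0 ?scaler0// shift_expo1; lia.
Qed.

(** The factor is z_0 (1 - al x) with x = z_1 / z_0: the linear factor in x goes into the series,
    and z_0 becomes the shift by [e0]. *)
Lemma var_sub_ratio_mul (al : F) c N : power_series1 N ->
  (var 0 - al *: var 1) ** ratio_mul c N
  = fun a => ratio_mul (mul_lin al c) N (a - e0).
Proof.
move=> N0; apply/funext => a; apply/funext => v; rewrite var_sub_mul.
have a10 : (a - e0) 1 = a 1 by rewrite !ffunE /= subr0.
have a11 : (a - e1) 1 = a 1 - 1 by rewrite !ffunE /=.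
case: (ltP (a 1) 0) => [alt|ale].
  by rewrite !ratio_mul_neg ?a10 ?a11 ?scaler0 ?subr0//; lia.
rewrite /ratio_mul a10 a11.
under [RHS]eq_bigr => j _ do rewrite /mul_lin scalerBl.
rewrite sumrB; congr (_ - _); rewrite scaler_sumr.
case: (a 1) ale a11 => // -[|m] _ a11.
  (* For [a 1 = 0] the other sum is taken at exponent -1, where the absolute value leaves two terms;
     both vanish by [N0]. *)
  rewrite big_ord1 mulr0 scale0r; apply: big1 => j _.
  by rewrite N0 ?scaler0// shift_expo1 a11; lia.
rewrite [RHS]big_ord_recl mulr0 scale0r add0r.
have -> : `|m.+1%:Z - 1|%N = m by lia.
apply: eq_bigr => j _; rewrite lift0 scalerA mulrS.
by congr (_ *: N _ v); rewrite !addrA subrK.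
Qed.

Lemma var_subs_ratio_mul (s : seq F) c N : power_series1 N ->
  foldr (fun al h => (var 0 - al *: var 1) ** h) (ratio_mul c N) s
  = fun a => ratio_mul (mul_lins s c) N (a - e0 *+ size s).
Proof.
move=> N0; elim: s => [|al s IH] /=; first by apply/funext => a; rewrite subr0.
rewrite IH; apply/funext => a; apply/funext => v; rewrite var_sub_mul.
have := congr1 (fun f => f (a - e0 *+ size s) v)
  (var_sub_ratio_mul al (mul_lins s c) N0).
rewrite /= var_sub_mul mulrSr opprD addrA => <-.
by rewrite ![a - e0 *+ size s - _]addrAC.
Qed.

Lemma ratio_mul1 N : power_series1 N -> ratio_mul (fun m : nat => (m == 0%N)%:R) N = N.
Proof.
move=> N0; apply/funext => a; apply/funext => v.
case: (ltP (a 1) 0) => [alt|ale]; first by rewrite ratio_mul_neg ?N0.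
rewrite /ratio_mul big_ord_recl scale1r addr0 big1 ?addr0// => j _.
by rewrite lift0 scale0r.
Qed.

End TwoVariables.

(** * The defining relations with E acting by 0 and C by a scalar *)

Section HeisenbergRelations.
Variables (F : numFieldType) (V : lmodType F) (q : 'I_3 -> F) (k : F).
Variable H : int -> {linear V -> V}.
Hypothesis q_neq0 : forall i, q i != 0.
Hypothesis q_prod1 : q 0 * q 1 * q 2 = 1.
Hypothesis HeisH : is_Heisenberg q k H.

Local Notation X := (Heisenberg_Koperators k H).
Local Notation A := (fun r : nat => H r%:Z).
Local Notation B := (fun r : nat => H (- r%:Z)).

Definition heis_bracket (r : nat) : F := - (kappa q r * ((1 + k ^ (2 * r%:Z)) / r%:R)).

Lemma heis_comm_pos r s u : A r.+1 (A s.+1 u) = A s.+1 (A r.+1 u).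
Proof.
apply/eqP; rewrite -subr_eq0 (Heis_comm HeisH)//.
have -> : (r.+1%:Z + s.+1%:Z == 0) = false by lia.
by rewrite oppr0 scale0r.
Qed.

Lemma heis_comm_neg r s u : B r.+1 (B s.+1 u) = B s.+1 (B r.+1 u).
Proof. exact: (Heis_comm_neg HeisH). Qed.

Lemma heis_comm_pos_neg r s u : A r.+1 (B s.+1 u)
  = B s.+1 (A r.+1 u) + (if r == s then heis_bracket r.+1 else 0) *: u.
Proof.
apply/eqP; rewrite addrC -subr_eq (Heis_comm HeisH)//; apply/eqP.
congr (_ *: _); rewrite subr_eq0 eqz_nat eqSS.
by case: eqP => _; rewrite ?oppr0.
Qed.

(** In the expanded product the constant 1 cancels against (q_1 q_2 q_3)^r = 1, and each product of
    two q's is the inverse of the third. *)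
Lemma kappaE (r : nat) : kappa q r =
  (q 0)^-1 ^+ r + (q 1)^-1 ^+ r + (q 2)^-1 ^+ r - (q 0 ^+ r + q 1 ^+ r + q 2 ^+ r).
Proof.
have q2 : q 2 = (q 0)^-1 * (q 1)^-1.
  rewrite -invfM; apply: (@mulfI _ (q 0 * q 1)); first by rewrite mulf_neq0.
  by rewrite q_prod1 divff// mulf_neq0.
have e1 : lift ord0 ord0 = 1 :> 'I_3 by exact: val_inj.
have e2 : q (lift ord0 (lift ord0 ord0)) = q 2 by congr q; exact: val_inj.
rewrite /kappa !big_ord_recl !big_ord0 e1 e2 q2 invfM !invrK -!exprnP.
rewrite !exprMn !exprVn; field.
by rewrite !expf_neq0.
Qed.

Definition triple (al : 'I_3 -> F) : seq F := [:: al 0; al 1; al 2].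

(** This is the form required by [mul_lins_log_deriv]: the two lists hold the coefficients of w in
    the linear factors of g(z,w) g(z,C^2 w) and of its barred analogue. *)
Lemma heis_bracketE (r : nat) : r.+1%:R * heis_bracket r.+1
  = \sum_(a <- triple q ++ triple (fun i => q i * k ^ 2)) a ^+ r.+1
  - \sum_(a <- triple (fun i => (q i)^-1) ++ triple (fun i => (q i)^-1 * k ^ 2))
      a ^+ r.+1.
Proof.
have -> : heis_bracket r.+1
    = - (kappa q r.+1 * ((1 + (k ^ 2) ^+ r.+1) / r.+1%:R)).
  by rewrite exprnP exprz_exp.
rewrite kappaE !big_cons !big_nil !exprMn; field.
by rewrite nat1r pnatr_eq0.
Qed.

Definition var_subs_mul (s : seq F) (h : fdist 2 V) : fdist 2 V :=
  foldr (fun al h => (var 0 - al *: var 1) ** h) h s.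

Lemma prod_var_subs_mul (al : 'I_3 -> F) (h : fdist 2 V) :
  (\big[@fmul F V 2/fone]_(i < 3) (var 0 - al i *: var 1)) ** h
  = var_subs_mul (triple al) h.
Proof. exact: prod_var_sub_mul. Qed.

Lemma Cpow_scale (m : int) (v : V) : Cpow X m v = k ^ m *: v.
Proof.
have iter_scale (b : F) (D : {linear V -> V}) n :
    (forall u, D u = b *: u) -> iter n D v = b ^+ n *: v.
  move=> DE; elim: n => [|n IH] /=; first by rewrite expr0 scale1r.
  by rewrite IH DE exprS scalerA.
case: m => m; first exact: (iter_scale k).
by rewrite [LHS](iter_scale k^-1 (opCinv X) m.+1)// exprVn.
Qed.

Lemma Cpow0 (m : int) : Cpow X m 0 = 0.
Proof. by rewrite Cpow_scale scaler0. Qed.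

Lemma C2var_scale : C2var X 1 = k ^ 2 *: var 1 :> fdist 2 V.
Proof.
have -> : C2var X 1 = laurent [:: (k ^ 2, 0)] ** (var 1 : fdist 2 V).
  rewrite /C2var; congr (_ ** _); apply/funext => a; apply/funext => v.
  rewrite /fconst /laurent big_cons big_nil /= eq_sym.
  case: eqP => _; last by rewrite scale0r.
  by rewrite addr0; exact: (Cpow_scale 2).
by apply/funext => a; apply/funext => v; rewrite laurent_mul big_seq1 subr0.
Qed.

Lemma Kplus0 m : Kplus_coef X m 0 = 0.
Proof. exact: (exp_coef_zero A). Qed.

Lemma Kminus0 m : Kminus_coef X m 0 = 0.
Proof. exact: (exp_coef_zero B). Qed.

(** [exp_coef_comm] is used twice: for a single operator crossing an exponential, then for the other
    exponential, packed as [exp_lin]. *)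
Lemma Kplus_comm m n v :
  Kplus_coef X m (Kplus_coef X n v) = Kplus_coef X n (Kplus_coef X m v).
Proof.
apply: (@exp_coef_comm _ _ A (exp_lin A m)) => r u.
by rewrite /= -[LHS](@exp_coef_comm _ _ A (A r.+1))// => s w; exact: heis_comm_pos.
Qed.

Lemma Kminus_comm m n v :
  Kminus_coef X m (Kminus_coef X n v) = Kminus_coef X n (Kminus_coef X m v).
Proof.
apply: (@exp_coef_comm _ _ B (exp_lin B m)) => r u.
by rewrite /= -[LHS](@exp_coef_comm _ _ B (B r.+1))// => s w; exact: heis_comm_neg.
Qed.

Lemma heis_KK_same : rel_KK_same X.
Proof.
split; apply/funext => a; apply/funext => v; rewrite !in_var_mul//; try
  by move=> l; case: ifP => // _; rewrite ?Kplus0 ?Kminus0.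
- by case: ifP => _; case: ifP => _ //; rewrite ?Kplus0// Kplus_comm.
- by case: ifP => _; case: ifP => _ //; rewrite ?Kminus0// Kminus_comm.
Qed.

Definition normal_KK : fdist 2 V := Kminus X 1 ** Kplus X 0.

Lemma normal_KKE a v : normal_KK a v =
  if (a 0 <= 0) && (0 <= a 1) then
    Kminus_coef X (absz (a 1)) (Kplus_coef X (absz (a 0)) v) else 0.
Proof.
rewrite [LHS]in_var_mul//; last by move=> l; case: ifP => // _; rewrite Kminus0.
by case: (a 0 <= 0); case: (0 <= a 1); rewrite //= Kminus0.
Qed.

Lemma power_series_normal_KK : power_series1 normal_KK.
Proof. by move=> a v a1; rewrite normal_KKE ifF//; lia. Qed.

Lemma KK_ratio_mul c : log_deriv (fun r => r%:R * heis_bracket r) c ->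
  Kplus X 0 ** Kminus X 1 = ratio_mul c normal_KK.
Proof.
move=> lc; apply/funext => a; apply/funext => v.
rewrite in_var_mul//; last by move=> l; case: ifP => // _; rewrite Kplus0.
case: (ltP (a 1) 0) => [alt|ale].
  rewrite ratio_mul_neg//; last exact: power_series_normal_KK.
  by case: ifP => // _; rewrite Kplus0.
(* The shifts only raise the exponent of z_0, while the normal-ordered product has none that is
   positive. *)
case: (leP (a 0) 0) => [a0|a0]; last first.
  by rewrite [RHS]big1// => j _; rewrite normal_KKE shift_expo0 ifF ?scaler0//; lia.
set M := (maxn (absz (a 0)) (absz (a 1))).+1.
have aM0 : (absz (a 0%R) < M)%N by rewrite ltnS leq_max leqnn.
have aM1 : (absz (a 1%R) < M)%N by rewrite ltnS leq_max leqnn orbT.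
rewrite [LHS](@exp_coef_exchange _ _ A B heis_bracket
  heis_comm_pos heis_comm_neg heis_comm_pos_neg c M)//.
rewrite /ratio_mul (@big_ord_widen _ _ _ _ M (fun j : nat =>
  c j *: normal_KK (a + (unit_expo 0 - unit_expo 1) *+ j) v))//.
rewrite [RHS]big_mkcond; apply: eq_bigr => j _ /=.
rewrite normal_KKE shift_expo0 shift_expo1 /shifted_normal ltnS.
case: (leqP j (absz (a 1))) => j1; last by rewrite andbF scaler0.
rewrite andbT; case: (leqP j (absz (a 0))) => j0; last by rewrite ifF//; lia.
rewrite ifT; last by lia.
congr (_ *: exp_coef _ _ (exp_coef _ _ _)). 
  by move: (a 1) ale j1 => x; lia.
by move: (a 0) a0 j0 => x; lia.
Qed.

Lemma gfun2E (al : 'I_3 -> F) (h : fdist 2 V) :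
  gfun al (var 0) (var 1) ** gfun al (var 0) (C2var X 1) ** h
  = var_subs_mul (triple al ++ triple (fun i => al i * k ^ 2)) h.
Proof.
rewrite [RHS]/var_subs_mul foldr_cat -![foldr _ _ _]/(var_subs_mul _ _).
rewrite /gfun [LHS]prod_var_subs_mul C2var_scale; congr (var_subs_mul _ _).
by rewrite -prod_var_subs_mul; congr (_ ** _); apply: eq_bigr => i _; rewrite scalerA.
Qed.

(** Both sides become scalar series in z_1 / z_0 times the normal-ordered product: [c] on the left,
    1 on the right. The six linear factors on each side give z_0^6 and two series that agree by
    [mul_lins_log_deriv]. *)
Lemma heis_KK_opp : rel_KK_opp q X.
Proof.
have [c lc] := log_deriv_exists (fun r => r%:R * heis_bracket r).
rewrite /rel_KK_opp /= (gfun2E q) [gbar q _ _ ** _](gfun2E (fun i => (q i)^-1)).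
rewrite (KK_ratio_mul lc) -/normal_KK.
rewrite -[in RHS](ratio_mul1 power_series_normal_KK).
rewrite /var_subs_mul !var_subs_ratio_mul; try exact: power_series_normal_KK.
have -> // := funext (mul_lins_log_deriv heis_bracketE lc).
Qed.

Lemma Kfull_eq0 n (i j : 'I_n) (b : expo n) v :
  i != j -> b j != 0 -> Kfull X i b v = 0 :> V.
Proof.
move=> ij bj; apply: fmul_eq0 => b'; rewrite /Kminus {1}/in_var.
case: (b' =P _) => // b'E.
suff -> : KplusC2 X i (b - b') v = 0 by case: ifP => // _; rewrite Kminus0.
rewrite /KplusC2 /in_var ifF//; apply/negP => /eqP /(congr1 (fun x : expo n => x j)).
rewrite unit_expo_mulz eq_sym (negPf ij) !ffunE b'E unit_expo_mulz.
by rewrite eq_sym (negPf ij) subr0; exact/eqP.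
Qed.

(** K(z_i) does not involve z_j, so the exponent of z_j selects a single term of the delta
    function. *)
Lemma deltaCC_Kfull n (i j : 'I_n) (a : expo n) v : i != j ->
  (deltaCC X i j ** Kfull X i) a v =
  k ^ (- (2 * a j)) *: Kfull X i (a + (unit_expo i - unit_expo j) *~ a j) v.
Proof.
move=> ij; pose b : expo n := (unit_expo i - unit_expo j) *~ (- a j).
have expoE (m : int) l : ((unit_expo i - unit_expo j) *~ m) l
    = (if l == i then m else 0) - (if l == j then m else 0).
  by rewrite mulrzBl !ffunE !unit_expo_mulz.
rewrite (@fmul_single _ _ _ b) => [|b' nb].
  rewrite /deltaCC /in_ratio ifT; last first.
    by rewrite /b expoE eqxx (negPf ij) subr0.
  rewrite Cpow_scale /b expoE eqxx (negPf ij) subr0 mulrN.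
  by rewrite mulrNz opprK.
rewrite /deltaCC /in_ratio; case: (b' =P _) => // b'E.
rewrite (@Kfull_eq0 n i j)// ?Cpow0// !ffunE b'E expoE eqxx [j == i]eq_sym (negPf ij) sub0r.
rewrite opprK; apply: contra nb; rewrite addr_eq0 => /eqP aj.
by rewrite /b aj opprK {1}b'E.
Qed.

Hypothesis k_neq0 : k != 0.

(** Multiplying by z_i or by z_j leads to the same coefficient of K(z_i), with an extra k^2 for z_j;
    hence z_i - q_c z_j annihilates the product. *)
Lemma gfun_deltaCC_Kfull n (i j : 'I_n) c : i != j -> k ^ 2 * q c = 1 ->
  gfun q (var i) (var j) ** deltaCC X i j ** Kfull X i = 0.
Proof.
move=> ij kq; apply: (@prod_var_sub_mul0 _ _ _ _ _ _ c) => a v.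
have ai : (a - unit_expo i) j = a j by rewrite !ffunE eq_sym (negPf ij) subr0.
have aj : (a - unit_expo j) j = a j - 1 by rewrite !ffunE eqxx.
rewrite !deltaCC_Kfull// ai aj scalerA; congr (_ *: Kfull X i _ v).
  have -> : - (2 * (a j - 1)) = 2 - (2 * a j) by ring.
  by rewrite [k ^ (2 - _)]expfzDr// mulrA [q c * _]mulrC kq mul1r.
rewrite mulrzBr mulr1z opprB [_ *~ a j + _]addrC addrA.
by rewrite [a - unit_expo j + _]addrA subrK.
Qed.

Lemma heis_Ecur n (i : 'I_n) : Ecur X i = 0.
Proof.
by apply/funext => a; apply/funext => v; rewrite /Ecur /in_var; case: ifP.
Qed.

Lemma heis_EE c : k ^ 2 * q c = 1 -> rel_EE q X.
Proof.
move=> kq; rewrite /rel_EE /= !(@gfun_deltaCC_Kfull _ _ _ c)// !heis_Ecur.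
rewrite addr0 scaler0 !(fmul0r 0) !fmulr0 ?addr0//; exact: kills0_prod_var_sub.
Qed.

Lemma kills0_Kplus n (i : 'I_n) : kills0 (Kplus X i).
Proof. by apply: kills0_in_var => l; case: ifP => // _; exact: Kplus0. Qed.

Lemma kills0_Kminus n (i : 'I_n) : kills0 (Kminus X i).
Proof. by apply: kills0_in_var => l; case: ifP => // _; exact: Kminus0. Qed.

Lemma heis_KE : rel_KE q X.
Proof.
split; rewrite heis_Ecur fmul0r ?(fmulr0 (kills0_Kplus _)) ?(fmulr0 (kills0_Kminus _));
  rewrite !fmulr0//; exact: kills0_prod_var_sub.
Qed.

Lemma kills0_Xker : kills0 (@Xker F q V).
Proof.
have kG (i j : 'I_3) : kills0 (@Gser F q V 3 i j).
  by apply: kills0_in_ratio => l; case: ifP => // _; rewrite scaler0.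
rewrite /Xker /=; do !first [apply: kills0_var | apply: kills0_var_inv
  | apply: (kG) | apply: kills0M | apply: kills0B | apply: kills0D].
Qed.

Lemma heis_Serre : rel_Serre q X.
Proof.
rewrite /rel_Serre !heis_Ecur /fbracket !subrr; congr fSym.
rewrite fmul0r (fmulr0 (kills0_Kminus _)).
rewrite fmulr0; last by apply: kills0_in_ratio => l; exact: Cpow0.
rewrite scaler0 (fmulr0 kills0_Xker) (fmulr0 (kills0_var_inv _ _)).
exact: fmulr0 (kills0_var _ _).
Qed.

End HeisenbergRelations.

(** * The grading of the Fock module *)

Section FockGrading.
Variables (F : fieldType) (V : lmodType F) (q : 'I_3 -> F) (k : F).
Variables (H : int -> {linear V -> V}) (vac : V).
Hypothesis FockH : is_Fock q k H vac.

Implicit Types (g : seq nat -> F) (s t : seq nat) (d : int) (v : V).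

Local Notation mon := (Fock_monomial H vac).

Definition Fock_comb g : V := \sum_(s \in Fock_index) g s *: mon s.

(** A list witnessing finite support in the index set; it may be larger than the support, so that
    several vectors can share one list. *)
Definition spanning_seq (L : seq (seq nat)) g : Prop :=
  [/\ uniq L, forall s, s \in L -> Fock_index s & forall s, g s != 0 -> s \in L].

Lemma Fock_combE L g : spanning_seq L g ->
  Fock_comb g = \sum_(s <- L) g s *: mon s.
Proof.
move=> [uL LF gL]; rewrite /Fock_comb (fsbigE L)//.
- by rewrite big_seq_cond [RHS]big_seq; apply: eq_bigl => s;
    case: (boolP (s \in L)) => //= /LF sF; rewrite mem_set.
- move=> s _ sL; suff -> : g s = 0 by rewrite scale0r.
  by apply/eqP; apply: contraNT sL; exact: gL.
Qed.

Definition Fock_coord v : seq nat -> F := projT1 (cid (Fock_basis FockH v)).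

Lemma Fock_coordK v : Fock_comb (Fock_coord v) = v.
Proof. by rewrite /Fock_coord; case: cid => /= f [[_ _ vE] _]. Qed.

Lemma Fock_coord_span v : exists L, spanning_seq L (Fock_coord v).
Proof.
rewrite /Fock_coord; case: cid => /= f [[ffin fF _] _].
have /finite_seqP[r /seteqP[sub1 sub2]] := ffin.
have memr s : (s \in r) = (f s != 0) by apply/idP/idP => [/sub2|/sub1].
exists (undup r); split=> [|s|s]; rewrite ?undup_uniq// mem_undup memr//.
exact: fF.
Qed.

Lemma Fock_combK L g : spanning_seq L g -> Fock_coord (Fock_comb g) = g.
Proof.
move=> [uL LF gL]; rewrite /Fock_coord; case: cid => /= f [_]; apply; split=> //.
- by apply: (@sub_finite_set _ _ [set` L]%classic) => // s /gL.
- by move=> s /gL /LF.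
Qed.

(** Over a list spanning both vectors, the right-hand side is an expansion of [a *: u + v], and
    expansions are unique. *)
Lemma Fock_coordP (a : F) u v :
  Fock_coord (a *: u + v) = fun s => a * Fock_coord u s + Fock_coord v s.
Proof.
have [L1 [uL1 LF1 gL1]] := Fock_coord_span u.
have [L2 [uL2 LF2 gL2]] := Fock_coord_span v.
pose L := undup (L1 ++ L2).
have LF s : s \in L -> Fock_index s.
  by rewrite mem_undup mem_cat => /orP[/LF1|/LF2].
have spL g : (forall s, s \notin L1 -> s \notin L2 -> g s = 0) -> spanning_seq L g.
  move=> g0; split=> // [|s]; first exact: undup_uniq.
  apply: contraNT; rewrite mem_undup mem_cat negb_or => /andP[s1 s2].
  by rewrite g0.
have cu s : s \notin L1 -> Fock_coord u s = 0.
  by move=> sL; apply/eqP; apply: contraNT sL; exact: gL1.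
have cv s : s \notin L2 -> Fock_coord v s = 0.
  by move=> sL; apply/eqP; apply: contraNT sL; exact: gL2.
have sp := spL (fun s => a * Fock_coord u s + Fock_coord v s).
rewrite -[RHS](@Fock_combK L); last first.
  by apply: sp => s s1 s2; rewrite cu// cv// mulr0 addr0.
congr Fock_coord; rewrite -{1}(Fock_coordK u) -{1}(Fock_coordK v).
rewrite !(@Fock_combE L); try by [apply: spL => s /cu | apply: spL => s _ /cv |
  apply: spL => s /cu -> /cv ->; rewrite mulr0 addr0].
rewrite scaler_sumr -big_split; apply: eq_bigr => s _ /=.
by rewrite scalerDl scalerA.
Qed.

Definition Fock_degree s : int := - (sumn s)%:Z.

Definition Fock_component d g : seq nat -> F :=
  fun s => if Fock_degree s == d then g s else 0.

Lemma spanning_component L d g :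
  spanning_seq L g -> spanning_seq L (Fock_component d g).
Proof.
move=> [uL LF gL]; split=> // s; rewrite /Fock_component.
by case: ifP => [_|]; [exact: gL | rewrite eqxx].
Qed.

Definition Fock_proj d v : V := Fock_comb (Fock_component d (Fock_coord v)).

Lemma Fock_coord_proj d v :
  Fock_coord (Fock_proj d v) = Fock_component d (Fock_coord v).
Proof.
by have [L spL] := Fock_coord_span v; exact: Fock_combK (spanning_component d spL).
Qed.

Lemma Fock_coord_inj u v : Fock_coord u = Fock_coord v -> u = v.
Proof. by move=> E; rewrite -(Fock_coordK u) E Fock_coordK. Qed.

Lemma Fock_proj_linear d : linear (Fock_proj d).
Proof.
move=> a u v; apply: Fock_coord_inj; rewrite Fock_coord_proj !Fock_coordP.
rewrite !Fock_coord_proj; apply/funext => s; rewrite /Fock_component.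
by case: ifP; rewrite ?mulr0 ?addr0.
Qed.

Definition Fock_pr d : {linear V -> V} :=
  HB.pack (Fock_proj d) (GRing.isLinear.Build F V V *:%R _ (Fock_proj_linear d)).

Lemma Fock_coord0 : Fock_coord 0 = fun=> 0.
Proof.
have := Fock_coordP (-1) 0 0; rewrite scaler0 addr0 => E; apply/funext => s.
by rewrite E mulN1r addNr.
Qed.

Lemma Fock_proj_eq0 L d v : spanning_seq L (Fock_coord v) ->
  d \notin map Fock_degree L -> Fock_pr d v = 0.
Proof.
move=> [_ _ gL] dL; apply: Fock_coord_inj; rewrite Fock_coord_proj Fock_coord0.
apply/funext => s; rewrite /Fock_component; case: eqP => // sd.
apply/eqP; apply: contraNT dL => /gL sL.
by apply/mapP; exists s.
Qed.

Lemma Fock_bounded_grading : bounded_grading Fock_pr.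
Proof.
split.
- move=> v; have [L spL] := Fock_coord_span v.
  apply: (@sub_finite_set _ _ [set` map Fock_degree L]%classic) => // d /=.
  by apply: contraNT => dL; apply/eqP; exact: Fock_proj_eq0 spL dL.
- move=> v; have [L spL] := Fock_coord_span v.
  rewrite (@fsumTE _ _ (undup (map Fock_degree L))) ?undup_uniq//; last first.
    by move=> d; rewrite mem_undup; exact: Fock_proj_eq0.
  under eq_bigr => d _ do rewrite [Fock_pr _ _](Fock_combE (spanning_component d spL)).
  rewrite -{1}(Fock_coordK v) (Fock_combE spL) exchange_big /= big_seq [RHS]big_seq.
  apply: eq_bigr => s sL; rewrite (bigD1_seq (Fock_degree s)) ?undup_uniq//=; last first.
    by rewrite mem_undup map_f.
  rewrite /Fock_component eqxx big1 ?addr0// => d /negPf.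
  by rewrite eq_sym => ->; rewrite scale0r.
- move=> d e v; apply: Fock_coord_inj.
  rewrite Fock_coord_proj (fun_if Fock_coord) Fock_coord_proj Fock_coord0.
  apply/funext => s; rewrite /Fock_component; case: (eqVneq d e) => [->|/negPf de].
    by case: ifP => // ->.
  by case: eqP => // ->; rewrite de.
(* Degrees are negatives of natural numbers. *)
- exists 0 => d v d0; apply: Fock_coord_inj; rewrite Fock_coord_proj Fock_coord0.
  apply/funext => s; rewrite /Fock_component ifF// /Fock_degree; lia.
Qed.

(** Creation operators commute; 0 is excluded because [H 0] is unconstrained. *)
Lemma Fock_monomial_rem (n : nat) s : n \in s -> 0%N \notin s ->
  mon s = mon (n :: rem n s).
Proof.
elim: s => // m s IH; rewrite !inE negb_or /= => ns /andP[m0 s0].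
case: (m =P n) ns => [->//|/eqP mn]; rewrite eq_sym (negPf mn) /= => ns.
have n0 : (0 < n)%N by case: n ns {IH mn} => //; rewrite (negPf s0).
by rewrite IH//=; apply: (Heis_comm_neg (Fock_Heis FockH)); lia.
Qed.

Lemma Fock_monomial_perm s t : perm_eq s t -> 0%N \notin s -> mon s = mon t.
Proof.
elim: s t => [|n s IH] t; first by rewrite perm_sym => /perm_nilP ->.
move=> st s0; have nt : n \in t by rewrite -(perm_mem st) mem_head.
rewrite (Fock_monomial_rem nt) -?(perm_mem st)//=.
rewrite (IH (rem n t))//; last by move: s0; rewrite inE negb_or => /andP[].
by rewrite -(perm_cons n); apply: perm_trans st _; exact: perm_to_rem.
Qed.

(** Only sorted monomials belong to the basis; sorting changes neither the vector nor the degree.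
    The unsorted case is what creation operators produce. *)
Lemma Fock_pr_monomial s : 0%N \notin s -> Fock_pr (Fock_degree s) (mon s) = mon s.
Proof.
move=> s0; pose t := sort geq s.
have st : perm_eq s t by rewrite perm_sym perm_sort.
have tF : Fock_index t.
  apply/andP; split; first by apply: sort_sorted => m n; exact: leq_total.
  by rewrite -(perm_mem st).
rewrite (Fock_monomial_perm st s0).
have -> : Fock_degree s = Fock_degree t.
  by rewrite /Fock_degree !sumnE (perm_big _ st).
pose g r : F := (r == t)%:R.
have spg : spanning_seq [:: t] g.
  split=> // r; rewrite inE; first by move/eqP->.
  by rewrite /g; case: (r =P t) => // _; rewrite eqxx.
have tE : mon t = Fock_comb g.
  by rewrite (Fock_combE spg) big_seq1 /g eqxx scale1r.
apply: Fock_coord_inj; rewrite Fock_coord_proj tE (Fock_combK spg).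
apply/funext => r; rewrite /Fock_component /g; case: (r =P t) => [->|_].
  by rewrite eqxx.
by case: ifP.
Qed.

(** A vector of degree [d] is a combination of monomials of degree [d], so monomials suffice. *)
Lemma Fock_has_degree (D : {linear V -> V}) (m : int) :
  (forall s, 0%N \notin s ->
    Fock_pr (Fock_degree s + m) (D (mon s)) = D (mon s)) ->
  has_degree Fock_pr D m.
Proof.
move=> Dm d v vd; have [L spL] := Fock_coord_span v.
have -> : v = \sum_(s <- L) Fock_component d (Fock_coord v) s *: mon s.
  by rewrite -[LHS]vd; exact: Fock_combE (spanning_component d spL).
rewrite !linear_sum big_seq [RHS]big_seq; apply: eq_bigr => s sL.
rewrite !linearZ /= /Fock_component; case: eqP => [<-|_]; last by rewrite !scale0r.
by congr (_ *: _); apply: Dm; case: spL => _ /(_ s sL) /andP[].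
Qed.

Lemma Fock_monomial_cons (n : nat) s : H (- n%:Z) (mon s) = mon (n :: s).
Proof. by []. Qed.

Lemma has_degree_creation (n : nat) : (0 < n)%N ->
  has_degree Fock_pr (H (- n%:Z)) (- n%:Z).
Proof.
move=> n0; apply: Fock_has_degree => s s0; rewrite Fock_monomial_cons.
have -> : Fock_degree s - n%:Z = Fock_degree (n :: s) by rewrite /Fock_degree /=; lia.
by apply: Fock_pr_monomial; rewrite inE negb_or eq_sym -lt0n n0.
Qed.

(** Induction on the monomial, from the vacuum, which is killed. Moving [H r] past the first factor
    leaves a scalar only if [r = n], and then removing that factor raises the degree by exactly
    [r]. *)
Lemma has_degree_annihilation (r : nat) : (0 < r)%N -> has_degree Fock_pr (H r%:Z) r.
Proof.
move=> r0; apply: Fock_has_degree; elim=> [|n s IH] s0.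
  have -> : H r%:Z (mon [::]) = 0 by exact: (Fock_vac FockH).
  by rewrite linear0.
move: s0; rewrite inE negb_or => /andP[n0 s0].
have n_gt0 : (0 < n)%N by rewrite lt0n eq_sym.
have -> : H r%:Z (mon (n :: s)) = H (- n%:Z) (H r%:Z (mon s))
    - (if r == n then kappa q r * ((1 + k ^ (2 * r%:Z)) / r%:~R) else 0) *: mon s.
  have := Heis_comm (Fock_Heis FockH) (mon s) (r := r%:Z) (s := - n%:Z).
  rewrite subr_eq0 eqz_nat oppr_eq0 eqz_nat -lt0n.
  move=> /(_ r0 n_gt0) /eqP; rewrite subr_eq addrC => /eqP ->.
  by rewrite scaleNr.
have dE : Fock_degree (n :: s) + r%:Z = Fock_degree s + r%:Z - n%:Z.
  by rewrite /Fock_degree /=; lia.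
rewrite linearB dE has_degree_creation//; last by apply: IH.
congr (_ - _); rewrite linearZ /=; case: eqP => [->|_]; last by rewrite !scale0r.
by rewrite addrK; congr (_ *: _); exact: Fock_pr_monomial.
Qed.

Lemma Fock_H_has_degree (r : int) : r != 0 -> has_degree Fock_pr (H r) r.
Proof.
case: (intP r) => // n _; first exact: has_degree_annihilation.
exact: has_degree_creation.
Qed.

End FockGrading.

(** * The module structure *)

Lemma cexp_neq0 (R : realType) (x : R[i]) : cexp x != 0.
Proof.
apply/negP; rewrite /cexp eq_complex /= => /andP[/eqP c0 /eqP s0].
have /eqP := cos2Dsin2 (complex.Im x).
have e0 : expR (complex.Re x) != 0 by rewrite gt_eqF// expR_gt0.
move: c0 s0 => /eqP; rewrite mulf_eq0 (negPf e0) /= => /eqP -> /eqP.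
by rewrite mulf_eq0 (negPf e0) /= => /eqP ->; rewrite expr0n addr0 eq_sym oner_eq0.
Qed.

Lemma cexp_half_sqr (R : realType) (x : R[i]) : cexp (2^-1 * x) ^+ 2 = cexp x.
Proof.
have [a [b ->]] : exists a b : R, x = (a +i* b)%C by case: x => a b; exists a, b.
have -> : 2^-1 * (a +i* b)%C = ((2^-1 * a) +i* (2^-1 * b))%C :> R[i].
  apply: (@mulfI _ 2); first by rewrite pnatr_eq0.
  rewrite mulrA divff ?pnatr_eq0// mul1r.
  rewrite mulr_natl mulr2n; apply/eqP; rewrite eq_complex /=.
  by rewrite ![2^-1 * _]mulrC -!splitr !eqxx.
rewrite /cexp /= [in RHS](splitr a) [in RHS](splitr b) ![_ / 2]mulrC.
rewrite expRD cosD sinD expr2; apply/eqP; rewrite eq_complex /=.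
by apply/andP; split; apply/eqP; ring.
Qed.

Theorem proposition4p3 (R : realType) (q lnq : 'I_3 -> R[i])
    (hq0 : forall i, q i != 0)
    (hln : forall i, cexp (lnq i) = q i)
    (hq : q 0 * q 1 * q 2 = 1)
    (hgen : generic_q q)
    (c : 'I_3) (V : lmodType R[i]) (H : int -> {linear V -> V}) (vac : V) :
  let s := cexp (2^-1 * lnq c) in
  is_Fock q s^-1 H vac ->
  is_Kmodule q (Heisenberg_Koperators s^-1 H) /\
  has_level (Heisenberg_Koperators s^-1 H) s^-1.
Proof.
move=> s FockH; have s0 : s != 0 := cexp_neq0 _.
have HeisH := Fock_Heis FockH.
(* Since s^2 = q_c, this makes q_c the root of g at which the delta functions are supported. *)
have sq : s^-1 ^ 2 * q c = 1.
  by rewrite -hln -cexp_half_sqr -/s -exprnP -exprMn mulVf// expr1n.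
split=> //; split.
- exists (Fock_pr FockH); split; first exact: Fock_bounded_grading.
  + by move=> m d v _; exact: (linear0 (Fock_pr FockH _)).
  + exact: Fock_H_has_degree.
  + by move=> d v vd; rewrite addr0 [LHS](linearZZ (Fock_pr FockH d)) vd.
- by split=> v /=; rewrite scalerA ?divff ?mulVf ?scale1r// invr_eq0.
- by split=> [m v|r v _] /=; rewrite ?scaler0 ?linearZ.
- by apply: heis_EE sq; rewrite invr_eq0.
- exact: (heis_KK_same HeisH).
- exact: (heis_KK_opp hq0 hq HeisH).
- exact: heis_KE.
- exact: heis_Serre.
Qed.
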